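(* Let $\mathcal{S}_{\boldsymbol{\alpha}}$ be a linear subdivision scheme, let $\boldsymbol{\gamma}$ solve $\boldsymbol{\gamma}\ast(\boldsymbol{\alpha}\downarrow2)=\boldsymbol{\delta}$, let $\varepsilon>0$, and let $\boldsymbol{\zeta}$ be the normalized truncated mask $\zeta_k=\widetilde\gamma_k/\sum_{i\in\Omega_\varepsilon}\widetilde\gamma_i$. Let $\boldsymbol{c}^{(J)}$ be a real-valued sequence and denote by $\{\boldsymbol{c}^{(0)};\boldsymbol{d}^{(1)},\dots,\boldsymbol{d}^{(J)}\}$ its multiscale transform generated by $$\boldsymbol{c}^{(\ell-1)}=\mathcal{D}_{\boldsymbol{\zeta}}\boldsymbol{c}^{(\ell)},\qquad \boldsymbol{d}^{(\ell)}=\boldsymbol{c}^{(\ell)}-\mathcal{S}_{\boldsymbol{\alpha}}\boldsymbol{c}^{(\ell-1)},\qquad \ell=1,2,\dots,J.$$ Then $$\|\boldsymbol{d}^{(\ell)}\|_\infty\le K_{\boldsymbol{\alpha},\boldsymbol{\zeta}}\,\Delta\boldsymbol{c}^{(\ell)},\qquad \ell=1,2,\dots,J,$$ where $K_{\boldsymbol{\alpha},\boldsymbol{\zeta}}=K_{\boldsymbol{\zeta}}\|\boldsymbol{\alpha}\|_1+MK_{\boldsymbol{\alpha}}$ with $M=\sum_{i\in\Omega_\varepsilon}|\zeta_i|$, $K_{\boldsymbol{\zeta}}=2\sum_{i\in\Omega_\varepsilon}|\zeta_i||i|$ and $K_{\boldsymbol{\alpha}}=\sum_{i\in\mathbb{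Z}}|\alpha_i||i|$.
   Context: All sequences are bi-infinite real sequences indexed by $\mathbb{Z}$. $(\boldsymbol{c}\downarrow2)_k=c_{2k}$; $\boldsymbol\delta$ is the Kronecker delta sequence; $\|\boldsymbol{v}\|_\infty=\sup_k|v_k|$; $\|\boldsymbol v\|_1=\sum_k|v_k|$; $\Delta\boldsymbol{c}=\sup_k|c_{k+1}-c_k|$. $\boldsymbol{\alpha}$ is finitely supported with $\sum_i\alpha_{2i}=\sum_i\alpha_{2i+1}=1$ (shift invariance; all subdivision schemes considered are convergent, which implies this), and $\mathcal{S}_{\boldsymbol{\alpha}}(\boldsymbol{c})_k=\sum_i\alpha_{k-2i}c_i$. For a sequence $\boldsymbol\eta$ summing to $1$, the decimation operator is $\mathcal{D}_{\boldsymbol{\eta}}(\boldsymbol{c})_k=\sum_i\eta_{k-i}c_{2i}$. The solution $\boldsymbol\gamma$ satisfies $\sum_i\gamma_i=1$ and $|\gamma_k|\le C\lambda^{|k|}$ for some $C>0$, $0<\lambda<1$. Truncation: $\widetilde\gamma_k=\gamma_k$ if $|\gamma_k|>\varepsilon$ and $\widetilde\gamma_k=0$ otherwise; $\Omega_\varepsilon$ is the finite support of $\widetilde{\boldsymbol\gamma}$. It is assumed that $\sum_{i\in\Omega_\varepsilon}\widetilde\gamma_i\neq0$, so that $\boldsymbol\zeta$ is defined and $\sum_k\zeta_k=1$. *)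

(* Defs.v *)
From HB Require Import structures.
From mathcomp Require Import all_boot all_order all_algebra.
From mathcomp Require Import boolp classical_sets cardinality fsbigop.
From mathcomp Require Import reals ereal topology normedtype.
From mathcomp.analysis.showcase Require summability.

Set Implicit Arguments.
Unset Strict Implicit.
Unset Printing Implicit Defensive.

Import Order.TTheory GRing.Theory Num.Theory.
Import numFieldNormedType.Exports.

Local Open Scope classical_set_scope.
Local Open Scope ring_scope.

Section sequences.
Context {R : realType}.
Implicit Types (v w alpha eta gamma zeta c : int -> R) (k : int).

(* Unordered sum over Z: the limit of the partial sums along the directed set
   of finite subsets of Z. It is meaningful for absolutely summable (in
   particular finitely supported) sequences. *)
Definition zsum v : R := summability.sum v.

Definition supp v : set int := [set k | v k != 0].

Definition kronecker : int -> R := fun k => (k == 0)%:R.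

Definition downsample2 v : int -> R := fun k => v (2 * k).

Definition conv v w : int -> R := fun k => zsum (fun i => v i * w (k - i)).

Definition norm1 v : R := zsum (fun k => `|v k|).

(* The two suprema below are extended reals, as sequences may be unbounded. *)
Definition norm_infty v : \bar R := ereal_sup [set `|v k|%:E | k in [set: int]].

Definition Delta v : \bar R :=
  ereal_sup [set `|v (k + 1) - v k|%:E | k in [set: int]].

Definition shift_invariant alpha : Prop :=
  zsum (fun i => alpha (2 * i)) = 1 /\ zsum (fun i => alpha (2 * i + 1)) = 1.

Definition subdivision alpha c : int -> R :=
  fun k => zsum (fun i => alpha (k - 2 * i) * c i).

Definition decimation eta c : int -> R :=
  fun k => zsum (fun i => eta (k - i) * c (2 * i)).

Definition geometric_decay v : Prop :=
  exists C lambda : R, [/\ 0 < C, 0 < lambda < 1 &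
    forall k, `|v k| <= C * lambda ^+ `|k|%N].

Definition truncation gamma (eps : R) : int -> R :=
  fun k => if eps < `|gamma k| then gamma k else 0.

Definition Omega gamma (eps : R) : set int := supp (truncation gamma eps).

Definition truncated_mass gamma (eps : R) : R :=
  \sum_(i \in Omega gamma eps) truncation gamma eps i.

Definition normalized_truncation gamma (eps : R) : int -> R :=
  fun k => truncation gamma eps k / truncated_mass gamma eps.

(* The levels [c l] for [l > J] and [d l] for [l = 0] or [l > J] are
   irrelevant. *)
Definition multiscale_transform alpha eta (J : nat) (cJ : int -> R)
    (c d : nat -> int -> R) : Prop :=
  c J = cJ /\
  forall l : nat, (1 <= l <= J)%N ->
    c l.-1 = decimation eta (c l) /\
    d l = (fun k => c l k - subdivision alpha (c l.-1) k).

Definition K_alpha alpha : R := zsum (fun i => `|alpha i| * `|i|%:~R).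

(* [Om] is a finite index set containing the support of [zeta]. *)
Definition K_zeta (Om : set int) zeta : R :=
  2 * \sum_(i \in Om) (`|zeta i| * `|i|%:~R).

Definition M_zeta (Om : set int) zeta : R := \sum_(i \in Om) `|zeta i|.

Definition K_alpha_zeta alpha (Om : set int) zeta : R :=
  K_zeta Om zeta * norm1 alpha + M_zeta Om zeta * K_alpha alpha.

End sequences.

(* Main.v *)
(* Since the mask [alpha] sums to 1 on each coset of 2Z and [zeta] sums to 1,
   the detail [d_k] is the iterated weighted average
     sum_i alpha_(k-2i) sum_j zeta_j (c_k - c_(2(i-j))).
   Each difference is at most [(|k-2i| + 2|j|) Delta c], and summing over all
   indices [m] instead of the [m = k-2i] only increases the bound. *)
Require Import Defs.
From mathcomp Require Import all_boot all_order all_algebra.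
From mathcomp Require Import boolp classical_sets cardinality fsbigop.
From mathcomp Require Import reals ereal topology normedtype.
From mathcomp Require Import finmap functions sequences zify ring.

Set Implicit Arguments.
Unset Strict Implicit.
Unset Printing Implicit Defensive.

Import Order.TTheory GRing.Theory Num.Theory.
Import numFieldNormedType.Exports.

Local Open Scope classical_set_scope.
Local Open Scope ring_scope.

(** * Calculus of [zsum] on finitely supported sequences *)

Section zsum.
Context {R : realType}.
Implicit Types (v w u b : int -> R) (k : int).

Lemma finite_supp_sub v w :
  finite_set (supp w) -> (forall i, w i = 0 -> v i = 0) -> finite_set (supp v).
Proof.
move=> fw wv; apply: sub_finite_set fw => i; rewrite /supp /=.
by apply: contra_neq => /wv.
Qed.

Lemma finite_supp_comp (h : int -> int) v :
  injective h -> finite_set (supp v) -> finite_set (supp (v \o h)).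
Proof. by move=> hI; apply: finite_preimage => i j _ _; exact: hI. Qed.

(** The net of partial sums is constant from [A] on: enlarging [A] only adds zero terms. *)
Lemma zsum_fset v (A : {fset int}) :
  (forall i, i \notin A -> v i = 0) -> zsum v = \sum_(i <- A) v i.
Proof.
move=> vA; have pf := @summability.totally_filter int.
apply: cvg_lim => //; apply: cvg_near_cst; exists A => // B /= AB.
rewrite /summability.partial_sum -(big_seq_fsetE _ B xpredT v) /=.
rewrite [RHS](big_fset_incl _ AB) // => i _; exact: vA.
Qed.

Lemma zsumE v : finite_set (supp v) -> zsum v = \sum_(i \in [set: int]) v i.
Proof.
move=> fv.
have v0 i : i \notin fset_set (supp v) -> v i = 0.
  by rewrite in_fset_set // notin_setE /supp /= => /negP/negPn/eqP.
by rewrite (zsum_fset v0) (@fsbigTE _ _ _ _ _ _ v0).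
Qed.

Lemma eq_zsum v w : v =1 w -> zsum v = zsum w.
Proof. by move=> /funext ->. Qed.

(** Links the sums over [Omega] in the constants of the theorem with sums over all integers. *)
Lemma fsbig_zsum v (S : set int) :
  finite_set (supp v) -> supp v `<=` S -> \sum_(i \in S) v i = zsum v.
Proof.
move=> fv vS; rewrite zsumE //; apply: fsbig_widen => // i [_ nSi] /=.
by apply/eqP/negPn/negP => vi; apply/nSi/vS.
Qed.

(** The union of the two supports serves as [A]; [f 0 0 = 0] keeps the combined sequence supported
    in it. Linearity and monotonicity of [zsum] thus reduce to finite sums. *)
Lemma zsum_common v w : finite_set (supp v) -> finite_set (supp w) ->
  exists A : {fset int}, [/\ zsum v = \sum_(i <- A) v i,
    zsum w = \sum_(i <- A) w i &
    forall f : R -> R -> R, f 0 0 = 0 ->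
      zsum (fun i => f (v i) (w i)) = \sum_(i <- A) f (v i) (w i)].
Proof.
move=> fv fw; exists (fset_set (supp v `|` supp w)).
have vw i : i \notin fset_set (supp v `|` supp w) -> v i = 0 /\ w i = 0.
  rewrite in_fset_set ?finite_setU // notin_setE /supp /= => /not_orP[].
  by move=> /negP/negPn/eqP -> /negP/negPn/eqP ->.
by split=> [||f f0]; apply: zsum_fset => i /vw[v0 w0]; rewrite ?v0 ?w0.
Qed.

Lemma zsumB v w : finite_set (supp v) -> finite_set (supp w) ->
  zsum (fun i => v i - w i) = zsum v - zsum w.
Proof.
move=> fv fw; have [A [-> -> vw]] := zsum_common fv fw.
by rewrite (vw (fun x y => x - y)) ?subr0 // sumrB.
Qed.

Lemma zsumD v w : finite_set (supp v) -> finite_set (supp w) ->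
  zsum (fun i => v i + w i) = zsum v + zsum w.
Proof.
move=> fv fw; have [A [-> -> vw]] := zsum_common fv fw.
by rewrite (vw (fun x y => x + y)) ?addr0 // big_split.
Qed.

Lemma zsumZ a v : finite_set (supp v) -> zsum (fun i => v i * a) = zsum v * a.
Proof.
move=> fv; have [A [-> _ vv]] := zsum_common fv fv.
by rewrite (vv (fun x _ => x * a)) ?mul0r // mulr_suml.
Qed.

Lemma ler_zsum v w : finite_set (supp v) -> finite_set (supp w) ->
  (forall i, v i <= w i) -> zsum v <= zsum w.
Proof.
by move=> fv fw vw; have [A [-> -> _]] := zsum_common fv fw; apply: ler_sum.
Qed.

Lemma ler_norm_zsum v : finite_set (supp v) -> `|zsum v| <= zsum (fun i => `|v i|).
Proof.
move=> fv; have [A [-> _ vv]] := zsum_common fv fv.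
by rewrite (vv (fun x _ => `|x|)) ?normr0 // ler_norm_sum.
Qed.

Lemma zsum_ge0 v : (forall i, 0 <= v i) -> finite_set (supp v) -> 0 <= zsum v.
Proof. by move=> v0 fv; rewrite zsumE // fsumr_ge0. Qed.

Lemma zsum_reindex (h : int -> int) v : bijective h -> finite_set (supp v) ->
  zsum (v \o h) = zsum v.
Proof.
move=> hB fv; rewrite (zsumE fv) (@reindex_fsbigT _ _ _ _ _ h v hB) zsumE //.
exact: finite_supp_comp (bij_inj hB) fv.
Qed.

Lemma zsum_reindex_le (h : int -> int) v : injective h -> (forall i, 0 <= v i) ->
  finite_set (supp v) -> zsum (v \o h) <= zsum v.
Proof.
move=> hI v0 fv; have fvh := finite_supp_comp hI fv.
(* The patched sequence is [v] cut to zero off the range of [h]. Its sum is that of [v \o h], and it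
   lies below [v] because [v] is nonnegative. *)
have fp : finite_set (supp (patch (fun=> 0) (range h) v)).
  by apply: (finite_supp_sub fv) => i vi; rewrite /patch; case: ifP.
rewrite (zsumE fvh) -(@fsbig_image _ _ _ _ _ _ h v); last first.
  by move=> i j _ _; exact: hI.
rewrite fsbig_mkcond -zsumE //; apply: ler_zsum => // i.
by rewrite /patch; case: ifP.
Qed.

(** Weights summing to 1 reproduce [x], so the difference is the weighted sum of the [x - u i]. The
    weights may be negative, hence their absolute values in the bound. *)
Lemma norm_weighted_sum_le w u b x : finite_set (supp w) -> zsum w = 1 ->
  (forall i, `|x - u i| <= b i) ->
  `|x - zsum (fun i => w i * u i)| <= zsum (fun i => `|w i| * b i).
Proof.
move=> fw w1 ub; have fm f : finite_set (supp (fun i => w i * f i)).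
  by apply: (finite_supp_sub fw) => i ->; rewrite mul0r.
have -> : x - zsum (fun i => w i * u i) = zsum (fun i => w i * (x - u i)).
  under [in RHS]eq_zsum do rewrite mulrBr.
  by rewrite zsumB // ?zsumZ ?w1 ?mul1r.
apply: le_trans (ler_norm_zsum _) _ => //; apply: ler_zsum.
- by apply: (finite_supp_sub fw) => i ->; rewrite mul0r normr0.
- by apply: (finite_supp_sub fw) => i ->; rewrite normr0 mul0r.
- by move=> i; rewrite normrM ler_wpM2l.
Qed.

End zsum.

(** * Estimates for the decimation and subdivision operators *)

Section scheme.
Context {R : realType}.
Implicit Types (alpha gamma zeta c : int -> R) (k : int).

(** The difference telescopes into [|m - n|] unit steps, each at most [D]. *)
Lemma lipschitz_of_Delta c (D : R) : (forall k, `|c (k + 1) - c k| <= D) ->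
  forall m n : int, `|c m - c n| <= `|m - n|%:~R * D.
Proof.
move=> cD.
have step (a : int) (n : nat) : `|c (a + n%:Z) - c a| <= n%:R * D.
  elim: n => [|n IH]; first by rewrite addr0 subrr normr0 mul0r.
  rewrite intS [1 + _]addrC addrA -nat1r mulrDl mul1r.
  by apply: le_trans (ler_distD (c (a + n%:Z)) _ _) _; apply: lerD.
have le_dist (m n : int) : n <= m -> `|c m - c n| <= `|m - n|%:~R * D.
  move=> nm; have mE : m = n + `|m - n|%N%:Z by lia.
  by rewrite [in c m]mE; apply: le_trans (step n _) _; rewrite -abszE.
move=> m n; have [/le_dist //|/ltW /le_dist] := leP n m.
by rewrite distrC [X in X%:~R]distrC.
Qed.

(** The parity of [k] selects the coset: for [k = 2m] or [k = 2m + 1], the reflection of [i] into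
    [m - i] turns [k - 2i] into [2i] or [2i + 1]. *)
Lemma zsum_shift_invariant alpha k : finite_set (supp alpha) ->
  shift_invariant alpha -> zsum (fun i => alpha (k - 2 * i)) = 1.
Proof.
move=> fa [a0 a1].
have reflB (m : int) : bijective (fun i : int => m - i).
  by exists (fun i : int => m - i) => i; ring.
have [m [kE|kE]] : exists m : int, k = 2 * m \/ k = 2 * m + 1.
- by exists (k %/ 2)%Z; lia.
- have f0 : finite_set (supp (fun i => alpha (2 * i))).
    by apply: (finite_supp_comp _ fa) => i j; lia.
  rewrite -a0 -(zsum_reindex (reflB m) f0).
  by apply: eq_zsum => i /=; congr alpha; lia.
- have f1 : finite_set (supp (fun i => alpha (2 * i + 1))).
    by apply: (finite_supp_comp _ fa) => i j; lia.
  rewrite -a1 -(zsum_reindex (reflB m) f1).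
  by apply: eq_zsum => i /=; congr alpha; lia.
Qed.

Lemma norm_sub_decimation_le zeta c (D : R) k (i : int) :
  finite_set (supp zeta) -> zsum zeta = 1 ->
  (forall n, `|c (n + 1) - c n| <= D) ->
  `|c k - decimation zeta c i| <=
    (zsum (fun j => `|zeta j|) * `|k - 2 * i|%:~R +
     2 * zsum (fun j => `|zeta j| * `|j|%:~R)) * D.
Proof.
move=> fz z1 cD.
have fn : finite_set (supp (fun j => `|zeta j|)).
  by apply: (finite_supp_sub fz) => j ->; rewrite normr0.
have fm (f : int -> R) : finite_set (supp (fun j => `|zeta j| * f j)).
  by apply: (finite_supp_sub fn) => j ->; rewrite mul0r.
have fm2 f a : finite_set (supp (fun j => `|zeta j| * f j * a)).
  by apply: (finite_supp_sub (fm f)) => j ->; rewrite mul0r.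
(* Reflecting the index puts the weight on [zeta j] alone, so the decimated value is an average with
   weights summing to 1. *)
have -> : decimation zeta c i = zsum (fun j => zeta j * c (2 * (i - j))).
  have reflB : bijective (fun j : int => i - j).
    by exists (fun j : int => i - j) => j; ring.
  rewrite -(zsum_reindex reflB); last first.
    by apply: (finite_supp_sub fz) => j ->; rewrite mul0r.
  by apply: eq_zsum => j /=; rewrite subKr.
have D0 : 0 <= D by apply: le_trans (cD 0).
(* Lipschitz bound for [c k - c (2 * (i - j))], after splitting [|k - 2i + 2j|] by the triangle
   inequality. *)
pose b (j : int) : R := (`|k - 2 * i|%:~R + 2 * `|j|%:~R) * D.
apply: (@le_trans _ _ (zsum (fun j => `|zeta j| * b j))).
  apply: norm_weighted_sum_le => // j.
  apply: le_trans (lipschitz_of_Delta cD _ _) _; rewrite ler_wpM2r //.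
  have : (`|k - 2 * (i - j)| <= `|k - 2 * i| + 2 * `|j|)%R by lia.
  by rewrite -(ler_int R) rmorphD rmorphM.
(* The right-hand side is folded into a single sum, which equals the left one term by term. *)
rewrite [X in _ <= (_ + X) * _]mulrC -zsumZ // -zsumZ // -zsumD // -zsumZ //; last first.
  by apply: (finite_supp_sub fz) => j ->; rewrite normr0 !mul0r addr0.
rewrite le_eqVlt; apply/orP; left; apply/eqP/eq_zsum => j; rewrite /b; ring.
Qed.

(** The weights [alpha (k - 2 * i)] average the bounds of [norm_sub_decimation_le]: the part
    constant in [i] produces [norm1 alpha], the part proportional to [|k - 2i|] produces
    [K_alpha alpha]. *)
Lemma norm_detail_le alpha zeta c (D : R) k :
  finite_set (supp alpha) -> shift_invariant alpha ->
  finite_set (supp zeta) -> zsum zeta = 1 ->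
  (forall n, `|c (n + 1) - c n| <= D) ->
  `|c k - subdivision alpha (decimation zeta c) k| <=
    (2 * zsum (fun j => `|zeta j| * `|j|%:~R) * norm1 alpha +
     zsum (fun j => `|zeta j|) * K_alpha alpha) * D.
Proof.
move=> fa sa fz z1 cD; set M := zsum (fun j => `|zeta j|); set K := 2 * _.
have D0 : 0 <= D by apply: le_trans (cD 0).
have K0 : 0 <= K.
  apply: mulr_ge0 => //; apply: zsum_ge0 => [j|].
    by rewrite mulr_ge0 // ler0z.
  by apply: (finite_supp_sub fz) => j ->; rewrite normr0 mul0r.
have M0 : 0 <= M.
  apply: zsum_ge0 => //.
  by apply: (finite_supp_sub fz) => j ->; rewrite normr0.
have hI : injective (fun i : int => k - 2 * i) by move=> i j; lia.
have fn : finite_set (supp (fun j => `|alpha j|)).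
  by apply: (finite_supp_sub fa) => j ->; rewrite normr0.
have fm (f : int -> R) : finite_set (supp (fun j => `|alpha j| * f j)).
  by apply: (finite_supp_sub fn) => j ->; rewrite mul0r.
have fm2 f a : finite_set (supp (fun j => `|alpha j| * f j * a)).
  by apply: (finite_supp_sub (fm f)) => j ->; rewrite mul0r.
have := norm_weighted_sum_le (finite_supp_comp hI fa)
  (zsum_shift_invariant k fa sa)
  (fun i => norm_sub_decimation_le k i fz z1 cD).
move=> /le_trans; apply; rewrite -/M -/K.
(* The summand as a function of [m = k - 2i], extended to all integers. Since [M], [K] and [D] are
   nonnegative, so is [v], and the extension can only enlarge the sum. *)
pose v m := `|alpha m| * ((M * `|m|%:~R + K) * D).
apply: (@le_trans _ _ (zsum v)).
  apply: (zsum_reindex_le hI) => [m|]; last exact: fm.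
  by rewrite !mulr_ge0 // addr_ge0 // mulr_ge0 // ler0z.
rewrite /norm1 /K_alpha [K * _]mulrC [M * _]mulrC -!zsumZ // -zsumD // -?zsumZ //.
- by rewrite le_eqVlt; apply/orP; left; apply/eqP/eq_zsum => j; rewrite /v; ring.
- by apply: (finite_supp_sub fn) => j ->; rewrite !mul0r addr0.
Qed.

Lemma finite_Omega gamma (eps : R) :
  geometric_decay gamma -> 0 < eps -> finite_set (Omega gamma eps).
Proof.
move=> [C [lambda [C0 /andP[l0 l1] gC]]] e0.
have : (GRing.exp lambda : nat -> R) @ \oo --> (0 : R).
  by apply: cvg_expr; rewrite gtr0_norm.
(* With threshold [eps / C], the decay bound [C * lambda ^+ n] is below [eps] for all [n >= N], so
   only indices with [|k| < N] survive truncation. *)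
move=> /cvgrPdist_lt /(_ (eps / C)); rewrite divr_gt0 // => /(_ isT)[N _ Nl].
(* The interval from [-N] to [N], as a shifted copy of the naturals up to [2N]. *)
apply: (@sub_finite_set _ _ ((fun n : nat => n%:Z - N%:Z) @` `I_(N + N).+1)).
  2: exact/finite_image/finite_II.
move=> k; rewrite /Omega /supp /truncation /=.
case: ifP => [ek _|_]; last by rewrite eqxx.
have kN : (`|k| < N)%N.
  rewrite ltnNge; apply/negP => /Nl /=.
  rewrite sub0r normrN gtr0_norm ?exprn_gt0 // ltr_pdivlMr // mulrC.
  by move=> /(le_lt_trans (gC k)) /(lt_trans ek); rewrite ltxx.
by exists (absz (k + N%:Z)); rewrite /=; lia.
Qed.

(* The odd-indexed mask coefficients sum to 1 and have weight [|i| >= 1]. *)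
Lemma K_alpha_ge1 alpha :
  finite_set (supp alpha) -> shift_invariant alpha -> 1 <= K_alpha alpha.
Proof.
move=> fa [_ a1]; have hI : injective (fun i : int => 2 * i + 1) by move=> i j; lia.
have fn : finite_set (supp (fun j => `|alpha j| * `|j|%:~R)).
  by apply: (finite_supp_sub fa) => j ->; rewrite normr0 mul0r.
apply: le_trans (zsum_reindex_le hI _ fn) => [|i]; last by rewrite mulr_ge0 // ler0z.
have fh := finite_supp_comp hI fa.
rewrite -[leLHS](@normr1 R) -[in leLHS]a1; apply: le_trans (ler_norm_zsum fh) _.
apply: ler_zsum => [||i /=].
- by apply: (finite_supp_sub fh) => j ->; rewrite normr0.
- exact: finite_supp_comp hI fn.
- by rewrite ler_peMr // ler1z; lia.
Qed.

End scheme.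

Theorem theorem3p2 (R : realType) (alpha gamma : int -> R) (eps : R)
    (J : nat) (cJ : int -> R) (c d : nat -> int -> R) :
  finite_set (supp alpha) ->
  shift_invariant alpha ->
  conv gamma (downsample2 alpha) = kronecker ->
  zsum gamma = 1 ->
  geometric_decay gamma ->
  0 < eps ->
  truncated_mass gamma eps != 0 ->
  let zeta := normalized_truncation gamma eps in
  multiscale_transform alpha zeta J cJ c d ->
  forall l : nat, (1 <= l <= J)%N ->
    (norm_infty (d l) <=
       (K_alpha_zeta alpha (Omega gamma eps) zeta)%:E * Delta (c l))%E.
Proof.
move=> fa sa _ _ gdec e0 m0 zeta [_ cd] l /cd [cE ->].
have fO := finite_Omega gdec e0.
have fz : finite_set (supp zeta).
  apply: (finite_supp_sub fO) => i ti.
  by rewrite /zeta /normalized_truncation ti mul0r.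
have z1 : zsum zeta = 1.
  by rewrite zsumZ // -(fsbig_zsum (S := Omega gamma eps)) // divff.
have zO : supp zeta `<=` Omega gamma eps.
  move=> i; rewrite /supp /Omega /supp /=; apply: contra_neq => ti.
  by rewrite /zeta /normalized_truncation ti mul0r.
have fn : finite_set (supp (fun j => `|zeta j|)).
  by apply: (finite_supp_sub fz) => j ->; rewrite normr0.
have fni : finite_set (supp (fun j => `|zeta j| * `|j|%:~R)).
  by apply: (finite_supp_sub fz) => j ->; rewrite normr0 mul0r.
have ME : M_zeta (Omega gamma eps) zeta = zsum (fun j => `|zeta j|).
  apply: fsbig_zsum => // i; rewrite /supp /= normr_eq0; exact: zO.
have KE : K_zeta (Omega gamma eps) zeta = 2 * zsum (fun j => `|zeta j| * `|j|%:~R).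
  congr (2 * _); apply: fsbig_zsum => // i.
  by rewrite /supp /= mulf_eq0 normr_eq0 negb_or => /andP[zi _]; exact: zO.
(* The absolute value of the sum of [zeta], which is 1, is at most the sum of the absolute
   values. *)
have M1 : 1 <= M_zeta (Omega gamma eps) zeta.
  by rewrite ME -[leLHS](@normr1 R) -[in leLHS]z1 ler_norm_zsum.
(* [K > 0] is needed when [Delta (c l) = +oo], because [0 * +oo = 0]. *)
have K0 : 0 < K_alpha_zeta alpha (Omega gamma eps) zeta.
  apply: ltr_wpDl.
    rewrite KE; apply: mulr_ge0; first apply: mulr_ge0 => //.
      by apply: zsum_ge0 => // j; rewrite mulr_ge0 // ler0z.
    by apply: le_trans (ler_norm_zsum fa).
  apply: mulr_gt0; first exact: lt_le_trans M1.
  exact: lt_le_trans (K_alpha_ge1 fa sa).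
have step k : (`|c l (k + 1) - c l k|%:E <= Delta (c l))%E.
  by apply: ereal_sup_ubound; exists k.
have D0 : (0 <= Delta (c l))%E by apply: le_trans (step 0); rewrite lee_fin.
(* Nonnegativity excludes [-oo]; for [+oo] the positive constant makes the right-hand side [+oo].
   Only a real [D] remains. *)
case DE : (Delta (c l)) D0 step => [D| |] // D0 step; last first.
  by rewrite gt0_muley ?lte_fin // leey.
apply: ge_ereal_sup => _ [k _ <-]; rewrite -EFinM lee_fin cE.
rewrite /K_alpha_zeta KE ME; exact: norm_detail_le.
Qed.
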